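(* (i) Let $\mu$ be a non-atomic measure and let $\varphi$ be an Orlicz function such that $\varphi(b_\varphi)\mu(\Omega)>1$ and $d_\varphi<b_\varphi$. Then there exist $a>0$ and $A\in\Sigma$ such that $x=a\chi_A$ satisfies $\|x\|_\varphi=1$ and $x$ is a uniformly non-$\ell_1^2$ point in $L_\varphi$. If $b_\varphi=\infty$, then $x\in(L_\varphi)_a$. (ii) Let $\mu$ be the counting measure on $\mathbb{N}$ and let $\varphi$ be an Orlicz function such that $d_\varphi<c_\varphi$ and $\varphi(c_\varphi)=1$. Then there exist $a>0$ and $A\subset\mathbb{N}$ such that $x=a\chi_A$ satisfies $\|x\|_\varphi=1$ and $x$ is a uniformly non-$\ell_1^2$ point in $\ell_\varphi$. If $b_\varphi=\infty$, then $x\in(\ell_\varphi)_a$.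
   Context: All spaces are real; $(\Omega,\Sigma,\mu)$ is a complete $\sigma$-finite measure space. An Orlicz function is a convex, left-continuous function $\varphi:[0,\infty)\to[0,\infty]$ with $\varphi(0)=0$, not identically zero and not identically infinite on $(0,\infty)$. Put $d_\varphi=\sup\{u\ge0:\varphi\text{ is linear on }[0,u]\}$ (i.e. $\varphi(v)=kv$ on $[0,u]$ for some $k\in[0,\infty)$), $c_\varphi=\sup\{u:\varphi(u)\le1\}$, $b_\varphi=\sup\{u:\varphi(u)<\infty\}$; if $b_\varphi=\infty$, $\varphi(b_\varphi)$ means $\lim_{u\to\infty}\varphi(u)=\infty$. For measurable $f:\Omega\to\mathbb{R}$ (modulo a.e. equality) let $I_\varphi(f)=\int_\Omega\varphi(|f|)\,d\mu$. The Orlicz space is the set of $f$ with $I_\varphi(\lambda f)<\infty$ for some $\lambda>0$, with the Luxemburg norm $\|f\|_\varphi=\inf\{\epsilon>0:I_\varphi(f/\epsilon)\le1\}$; it is denoted $L_\varphi$ when $\mu$ is non-atomic and $\ell_\varphi$ when $\Omega=\mathbb{N}$ with counting measure. For such a space $X$, $X_a$ is the set of order continuous elements: $f\in X$ such that for every sequence of measurable functions $(f_n)$ with $0\le f_n\le|f|$ and $f_n\downarrow0$ a.e. one has $\|f_n\|\downarrow0$. A point $x$ of the unit sphere $S_X$ of a Banach space $X$ is a uniformly non-$\ell_1^2$ point if there is $\delta>0$ such that $\min\{\|x+y\|,\|x-y\|\}\le2-\delta$ for all $y\in S_X$. *)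

(* Defs.v *)
From HB Require Import structures.
From mathcomp Require Import all_boot all_order all_algebra.
From mathcomp Require Import all_classical all_reals all_analysis.

Set Implicit Arguments.
Unset Strict Implicit.
Unset Printing Implicit Defensive.
Import Order.TTheory GRing.Theory Num.Theory.
Import numFieldNormedType.Exports.

Local Open Scope classical_set_scope.
Local Open Scope ring_scope.
Local Open Scope ereal_scope.

(* Functions [0, +oo[ -> [0, +oo] are represented by functions R -> \bar R
   whose values at negative arguments are never used.  By the conventions of
   [\bar R], 0 * +oo = 0, so [orlicz_convex] is harmless for t = 0, 1. *)
Record orlicz_function (R : realType) (phi : R -> \bar R) : Prop := {
  orlicz_ge0 : forall u, (0 <= u)%R -> 0 <= phi u ;
  orlicz_at0 : phi 0%R = 0 ;
  orlicz_convex : forall u v t, (0 <= u)%R -> (0 <= v)%R -> (0 <= t <= 1)%R ->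
    phi (t * u + (1 - t) * v)%R <= t%:E * phi u + (1 - t)%:E * phi v ;
  orlicz_left_continuous : forall u, (0 < u)%R ->
    phi x @[x --> u^'-] --> phi u ;
  orlicz_not_zero : exists2 u, (0 < u)%R & phi u != 0 ;
  orlicz_not_infty : exists2 u, (0 < u)%R & phi u != +oo }.

Section orlicz_parameters.
Context (R : realType) (phi : R -> \bar R).

Definition linear_upto (u : R) : Prop :=
  exists2 k : R, (0 <= k)%R & forall v, (0 <= v <= u)%R -> phi v = (k * v)%:E.

Definition orlicz_d : \bar R :=
  ereal_sup [set u%:E | u in [set u : R | (0 <= u)%R /\ linear_upto u]].

Definition orlicz_c : \bar R :=
  ereal_sup [set u%:E | u in [set u : R | (0 <= u)%R /\ phi u <= 1]].

Definition orlicz_b : \bar R :=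
  ereal_sup [set u%:E | u in [set u : R | (0 <= u)%R /\ phi u < +oo]].

(* phi(b) and phi(c) for b, c in [0, +oo]; the value at -oo is irrelevant
   since the parameters above are nonnegative. *)
Definition orlicz_ext (x : \bar R) : \bar R :=
  match x with
  | u%:E => phi u
  | +oo => lim (phi u @[u --> +oo%R])
  | -oo => 0
  end.

End orlicz_parameters.

Definition nonatomic d (T : measurableType d) (R : realType)
    (mu : set T -> \bar R) : Prop :=
  forall A, measurable A -> 0 < mu A ->
    exists B, [/\ measurable B, B `<=` A, 0 < mu B & mu B < mu A].

(* Elements of the Orlicz space are represented by measurable functions instead
   of their classes modulo a.e. equality; every notion below is invariant under
   a.e. equality of measurable functions. *)
Section orlicz_space.
Context d (T : measurableType d) (R : realType).
Variables (mu : {measure set T -> \bar R}) (phi : R -> \bar R).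

Definition modular (f : T -> R) : \bar R :=
  \int[mu]_(t in setT) phi `|f t|%R.

Definition orlicz_space : set (T -> R) :=
  [set f | measurable_fun setT f /\
           exists2 l : R, (0 < l)%R & modular (fun t => l * f t)%R < +oo].

(* The value is finite on [orlicz_space]. *)
Definition luxemburg (f : T -> R) : \bar R :=
  ereal_inf [set e%:E | e in
    [set e : R | (0 < e)%R /\ modular (fun t => f t / e)%R <= 1]].

Definition order_continuous (f : T -> R) : Prop :=
  orlicz_space f /\
  forall f_ : (T -> R)^nat,
    (forall n, measurable_fun setT (f_ n)) ->
    (forall n, {ae mu, forall t, (0 <= f_ n t <= `|f t|)%R}) ->
    {ae mu, forall t, nonincreasing_seq (f_ ^~ t)} ->
    {ae mu, forall t, f_ n t @[n --> \oo] --> 0%R} ->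
    nonincreasing_seq (fun n => luxemburg (f_ n)) /\
    luxemburg (f_ n) @[n --> \oo] --> 0.

End orlicz_space.

(* X is the underlying set of the Banach space and N its norm. *)
Definition uniformly_non_l12_point (R : realType) (V : zmodType) (X : set V)
    (N : V -> \bar R) (x : V) : Prop :=
  [/\ X x, N x = 1 &
    exists2 delta : R, (0 < delta)%R &
      forall y, X y -> N y = 1 ->
        Order.min (N (x + y)%R) (N (x - y)%R) <= (2 - delta)%:E].

(* Main.v *)
(** Let x = a 1_A with phi(a) mu(A) = 1 and d_phi < a.  As phi is not linear on
    [0, a], phi(a / 2) < phi(a) / 2.  For modular(y) <= 1, convexity gives on A,
    with v = |y|,
      phi((a + v) / 2) + phi(|a - v| / 2) <= phi(a) / 2 + phi(a / 2) + phi(v),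
    which beats phi(a) + phi(v) by a fixed amount; integrating,
    (x + y) / 2 or (x - y) / 2 has modular at most 1, with enough room to be
    dilated by some s > 1, provided that phi is finite beyond a.  In the sequence
    space a = c_phi need not satisfy the proviso, but A is an atom, so one of
    x + y, x - y has |a - v| on A and only phi(|a - v| / 2) matters.  In the
    non-atomic case A exists by Sierpinski's theorem. *)

Require Import Defs.
From mathcomp Require Import all_boot all_order all_algebra.
From mathcomp Require Import all_classical all_reals all_analysis.
From mathcomp Require Import measurable_realfun ring lra.

Set Implicit Arguments.
Unset Strict Implicit.
Unset Printing Implicit Defensive.
Import Order.TTheory GRing.Theory Num.Theory.
Import numFieldNormedType.Exports.

Local Open Scope classical_set_scope.
Local Open Scope ring_scope.
Local Open Scope ereal_scope.

(** * Convexity, growth and pointwise estimates for an Orlicz function *)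

Section orlicz_function_theory.
Context (R : realType) (phi : R -> \bar R).
Hypothesis phiO : orlicz_function phi.

Lemma orlicz_scale_le (t u : R) : (0 <= t <= 1)%R -> (0 <= u)%R ->
  phi (t * u)%R <= t%:E * phi u.
Proof.
move=> t01 u0.
have := orlicz_convex phiO u0 (lexx 0%R) t01.
by rewrite mulr0 addr0 (orlicz_at0 phiO) mule0 adde0.
Qed.

Lemma orlicz_le (u v : R) : (0 <= u)%R -> (u <= v)%R -> phi u <= phi v.
Proof.
move=> u0 uv.
have [v0|v0] := leP v 0%R; first by have -> : u = v by lra.
have uv1 : (0 <= u / v <= 1)%R by rewrite divr_ge0 ?(ltW v0)//= ler_pdivrMr ?mul1r.
have := orlicz_scale_le uv1 (ltW v0).
rewrite divfK ?gt_eqF// => /le_trans; apply.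
have phiv0 := orlicz_ge0 phiO (ltW v0).
by rewrite -[leRHS]mul1e lee_wpmul2r// lee_fin; case/andP: uv1.
Qed.

Lemma orlicz_fin_num (u v : R) : (0 <= u)%R -> (u <= v)%R -> phi v < +oo ->
  phi u \is a fin_num.
Proof.
move=> u0 uv phiv.
by rewrite ge0_fin_numE ?(orlicz_ge0 phiO u0)// (le_lt_trans _ phiv)// orlicz_le.
Qed.

Lemma orlicz_scale_ge (t u : R) : (1 <= t)%R -> (0 <= u)%R ->
  t%:E * phi u <= phi (t * u)%R.
Proof.
move=> t1 u0; have t0 : (0 < t)%R by lra.
have it : (0 <= t^-1 <= 1)%R by rewrite invr_ge0 (ltW t0)/= invf_le1.
have := orlicz_scale_le it (mulr_ge0 (ltW t0) u0).
by rewrite mulKf ?gt_eqF// muleC lee_pdivlMr// muleC.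
Qed.

(** Convexity and [phi 0 = 0] force at least linear growth beyond a point where [phi] is
    positive. *)
Lemma orlicz_unbounded (M : R) : exists2 v, (0 <= v)%R & M%:E < phi v.
Proof.
have [u u0 phiu0] := orlicz_not_zero phiO.
have phiu_gt0 : 0 < phi u by rewrite lt_def phiu0 (orlicz_ge0 phiO) ?ltW.
case phiuE : (phi u) => [r| |]; last 2 first.
- by exists u; [exact: ltW|rewrite phiuE ltry].
- by move: phiu_gt0; rewrite phiuE.
have r0 : (0 < r)%R by rewrite phiuE lte_fin in phiu_gt0.
pose t : R := (`|M| / r + 1)%R.
have t1 : (1 <= t)%R by rewrite lerDr divr_ge0// ltW.
exists (t * u)%R; first by rewrite mulr_ge0 ?(ltW u0)// (le_trans _ t1).
apply: lt_le_trans (orlicz_scale_ge t1 (ltW u0)).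
rewrite phiuE -EFinM lte_fin /t mulrDl divfK ?gt_eqF// mul1r.
by rewrite (le_lt_trans (ler_norm M))// ltrDl.
Qed.

Lemma orlicz_d_ge0 : 0 <= orlicz_d phi.
Proof.
apply: ereal_sup_ubound; exists 0%R => //; split => //.
exists 0%R => // v v0; have -> : v = 0%R by lra.
by rewrite mulr0 (orlicz_at0 phiO).
Qed.

(* If [phi (a / 2) = phi a / 2], convexity on both sides of [a / 2] forces the
   graph of [phi] on [0, a] to be a chord. *)
Lemma orlicz_half_lt (a : R) : orlicz_d phi < a%:E -> phi a < +oo ->
  phi (a / 2)%R < (2^-1)%:E * phi a.
Proof.
move=> da phia; rewrite ltNge; apply/negP => half.
have d0 := orlicz_d_ge0.
have a0 : (0 < a)%R by rewrite -lte_fin (le_lt_trans d0 da).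
suff : a%:E <= orlicz_d phi by rewrite leNgt da.
apply: ereal_sup_ubound; exists a => //; split; first exact: ltW.
have fin (v : R) : (0 <= v <= a)%R -> phi v \is a fin_num.
  by case/andP => v0 va; exact: orlicz_fin_num v0 va phia.
have [P PE] : exists P, phi a = P%:E.
  by exists (fine (phi a)); rewrite fineK// fin//; lra.
have P0 : (0 <= P)%R by rewrite -lee_fin -PE (orlicz_ge0 phiO) ?ltW.
have [Q QE] : exists Q, phi (a / 2)%R = Q%:E.
  by exists (fine (phi (a / 2)%R)); rewrite fineK// fin//; lra.
exists (P / a)%R; first by rewrite divr_ge0 ?(ltW a0).
move=> v va; have [V VE] : exists V, phi v = V%:E.
  by exists (fine (phi v)); rewrite fineK// fin.
have [v0 vlea] := andP va.
move: half; rewrite PE QE -EFinM lee_fin => half.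
rewrite VE; congr EFin.
pose k := (P / a)%R; have Pk : P = (k * a)%R by rewrite /k divfK ?gt_eqF.
have k0 : (0 <= k)%R by rewrite divr_ge0 ?(ltW a0).
rewrite -/k; apply/eqP; rewrite eq_le; apply/andP; split.
  have t01 : (0 <= v / a <= 1)%R by rewrite divr_ge0 ?(ltW a0)//= ler_pdivrMr ?mul1r.
  have := orlicz_scale_le t01 (ltW a0); rewrite divfK ?gt_eqF// VE PE -EFinM lee_fin.
  by have -> : (k * v = v / a * P)%R by rewrite /k; ring.
(* It remains to bound [phi v] below by the chord. If [v <= a / 2], then [a / 2] lies between [v]
   and [a], with weight [t] on [v]; otherwise it lies between [0] and [v]. A value [phi v] under the
   chord would pull [phi (a / 2)] under it as well. *)
have [vh|vh] := leP v (a / 2)%R.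
  pose t := (a / 2 / (a - v))%R.
  have av0 : (0 < a - v)%R by lra.
  have t0 : (0 < t)%R by rewrite !divr_gt0.
  have tE : (t * (a - v) = a / 2)%R by rewrite /t divfK ?gt_eqF.
  have t01 : (0 <= t <= 1)%R by rewrite (ltW t0)/= ler_pdivrMr ?mul1r//; lra.
  have := orlicz_convex phiO v0 (ltW a0) t01.
  have -> : (t * v + (1 - t) * a = a / 2)%R by lra.
  rewrite VE PE QE -!EFinM -EFinD lee_fin => QV.
  rewrite -(ler_pM2l t0).
  have : (t * (k * v) = k * a - k * (t * (a - v)) - (1 - t) * P)%R by rewrite Pk; ring.
  rewrite tE => ->; rewrite -Pk; move: half QV; rewrite Pk; lra.
have v_gt0 : (0 < v)%R by lra.
have t01 : (0 <= a / 2 / v <= 1)%R.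
  by rewrite divr_ge0 ?(ltW v_gt0) ?(divr_ge0 (ltW a0))//= ler_pdivrMr ?mul1r ?ltW.
have := orlicz_scale_le t01 (ltW v_gt0).
rewrite divfK ?gt_eqF// VE QE -EFinM lee_fin => QV.
have {QV}half : (k * a / 2 <= a / 2 / v * V)%R by rewrite -Pk; lra.
have : (k * v * (a / 2 / v) <= V * (a / 2 / v))%R.
  have -> : (k * v * (a / 2 / v) = k * a / 2)%R by field; rewrite gt_eqF.
  by rewrite [X in (_ <= X)%R]mulrC.
by rewrite ler_pM2r// !divr_gt0.
Qed.

(** By monotonicity on each side of 0, the value at a point between [s] and [t] is at most the
    larger end value, so strict sublevel sets are intervals. *)
Lemma measurable_orlicz_norm : measurable_fun setT (fun u : R => phi `|u|%R).
Proof.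
apply: (measurability _ (ErealGenInftyO.measurableE R)) => // _ [_ [r ->] <-].
rewrite setTI; apply: is_interval_measurable => s t /=; rewrite !in_itv/=.
move=> phis phit u /andP[su ut]; rewrite in_itv/=.
have [u0|u0] := leP 0%R u.
  apply: le_lt_trans phit; apply: orlicz_le => //.
  by rewrite ger0_norm// (le_trans ut)// ler_norm.
apply: le_lt_trans phis; apply: orlicz_le => //.
by rewrite !ltr0_norm// ?lerN2// (le_lt_trans su).
Qed.

(* The term [phi (s * a / 2)] of both estimates, unlike [phi (s * |p - v| / 2)],
   does not depend on [p] and [v]; this is where the gain is made. *)
Lemma orlicz_diff_le (s a p v : R) : (0 <= s <= 2)%R -> (0 <= v)%R ->
  (0 <= p <= a)%R ->
  phi (s / 2 * `|p - v|)%R <= (s / 2)%:E * phi v + phi (s / 2 * a)%R.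
Proof.
move=> s2 v0 pa; have a0 : (0 <= a)%R by lra.
have [s0 _] := andP s2.
have h0 : (0 <= s / 2)%R by lra.
have phia := orlicz_ge0 phiO (mulr_ge0 h0 a0).
have phiv := orlicz_ge0 phiO v0.
(* Since [|p - v|] is at most the larger of [a] and [v], one of the two nonnegative terms on the
   right already suffices. *)
have [va|av] := leP v a.
  apply: (@le_trans _ _ (phi (s / 2 * a)%R)).
    apply: orlicz_le; first by rewrite mulr_ge0.
    by rewrite ler_wpM2l// ler_norml; lra.
  by rewrite leeDr// mule_ge0.
apply: (@le_trans _ _ (phi (s / 2 * v)%R)).
  apply: orlicz_le; first by rewrite mulr_ge0.
  by rewrite ler_wpM2l// ler_norml; lra.
apply: (@le_trans _ _ ((s / 2)%:E * phi v)); last by rewrite leeDl.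
by apply: orlicz_scale_le => //; lra.
Qed.

(** The point [s / 2 * (a + v)] is the convex combination of [v] and [s * a / (2 - s)] with weights
    [s / 2] and [1 - s / 2]. The second point tends to [a] as [s] decreases to 1, so only values of
    [phi] slightly beyond [a] enter. *)
Lemma orlicz_sum_le (s a p v : R) : (0 <= s < 2)%R -> (0 <= v)%R ->
  (0 <= p <= a)%R ->
  phi (s / 2 * (p + v))%R <=
  (s / 2)%:E * phi v + (1 - s / 2)%:E * phi (s * a / (2 - s))%R.
Proof.
move=> s2 v0 pa; have a0 : (0 <= a)%R by lra.
have [s0 _] := andP s2.
have sa0 : (0 <= s * a / (2 - s))%R by rewrite divr_ge0// ?mulr_ge0//; lra.
apply: (@le_trans _ _ (phi (s / 2 * v + (1 - s / 2) * (s * a / (2 - s))))%R).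
  apply: orlicz_le; first by rewrite mulr_ge0//; lra.
  have -> : ((1 - s / 2) * (s * a / (2 - s)) = s / 2 * a)%R by field; lra.
  by rewrite mulrDr addrC lerD2l ler_wpM2l//; lra.
by apply: orlicz_convex => //; lra.
Qed.

End orlicz_function_theory.

(** * Choice of the dilation factor [s > 1] *)

Section dilation.
Context (R : realType) (phi : R -> \bar R).
Hypothesis phiO : orlicz_function phi.

Lemma orlicz_dilate_half_le (s a : R) : (1 <= s <= 2)%R -> (0 <= a)%R ->
  phi (s / 2 * a)%R <= (2 - s)%:E * phi (a / 2)%R + (s - 1)%:E * phi a.
Proof.
move=> s12 a0.
have -> : (s / 2 * a = (2 - s) * (a / 2) + (1 - (2 - s)) * a)%R by field.
have -> : (s - 1 = 1 - (2 - s))%R by ring.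
by apply: orlicz_convex => //; lra.
Qed.

(** At [s = 1] the left side is [1 / 2 + phi (a / 2) < 1]; the strict gap leaves room for some
    [s > 1]. *)
Lemma exists_dilation_atom (a : R) : (0 <= a)%R -> orlicz_d phi < a%:E ->
  phi a = 1 -> exists2 s, (1 < s < 2)%R & (s / 2)%:E + phi (s / 2 * a)%R <= 1.
Proof.
move=> a0 da phia.
have phia_lty : phi a < +oo by rewrite phia ltry.
have := orlicz_half_lt phiO da phia_lty; rewrite phia mule1 => half.
have fin : phi (a / 2)%R \is a fin_num.
  by apply: (orlicz_fin_num phiO _ _ phia_lty); lra.
have Q0 : 0 <= phi (a / 2)%R by apply: orlicz_ge0 => //; lra.
move: fin half Q0; case QE : (phi (a / 2)%R) => [Q| |]// _; rewrite !lte_fin !lee_fin.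
move=> half Q0.
(* With [s = 1 + e] the left side grows by at most [3 / 2 * e], while the gap [2^-1 - Q] equals
   [2 * e]. *)
pose s := (1 + (2^-1 - Q) / 2)%R; exists s; first by rewrite /s; lra.
have s12 : (1 <= s <= 2)%R by rewrite /s; lra.
apply: le_trans (leeD2l _ (orlicz_dilate_half_le s12 a0)) _.
rewrite QE phia mule1 -EFinM -!EFinD lee_fin.
have : (0 <= (2^-1 - Q) / 2 * Q)%R by rewrite mulr_ge0//; lra.
by rewrite /s; lra.
Qed.

(** At [s = 1] the inequality reads [3 / 2 * phi a + phi (a / 2) <= 2 * phi a] and is strict.
    Finiteness at [a'] bounds the growth of [phi] just beyond [a] by a chord, so the inequality
    survives for [s] near 1. *)
Lemma exists_dilation (a a' : R) : (0 < a)%R -> orlicz_d phi < a%:E ->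
  (a < a')%R -> phi a' < +oo -> 0 < phi a ->
  exists s, [/\ (1 < s < 2)%R, phi (s * a / (2 - s))%R < +oo &
    s%:E * phi a + (phi (s / 2 * a)%R + (1 - s / 2)%:E * phi (s * a / (2 - s))%R)
    <= 2%:E * phi a].
Proof.
move=> a0 da aa' phia'.
have phia_lty : phi a < +oo by rewrite (le_lt_trans _ phia')// orlicz_le// ltW.
have := orlicz_half_lt phiO da phia_lty.
have finQ : phi (a / 2)%R \is a fin_num.
  by apply: (orlicz_fin_num phiO _ _ phia_lty); lra.
have finP : phi a \is a fin_num.
  by apply: (orlicz_fin_num phiO _ _ phia_lty); lra.
have finM : phi a' \is a fin_num.
  by apply: (orlicz_fin_num phiO _ _ phia'); lra.
have Q0 : 0 <= phi (a / 2)%R by apply: orlicz_ge0 => //; lra.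
have PM : phi a <= phi a' by apply: orlicz_le => //; lra.
move: finQ finP finM Q0 PM.
case QE : (phi (a / 2)%R) => [Q| |]//; case PE : (phi a) => [P| |]//.
case ME : (phi a') => [M| |]// _ _ _; rewrite -EFinM !lte_fin !lee_fin.
move=> Q0 PM half P0.
(* [e * C] is the cost of replacing [phi a] by the chord bound at [s * a / (2 - s)], already
   weighted by [1 - s / 2]. *)
pose C := (a / (a' - a) * (M - P))%R.
have a'a : (0 < a' - a)%R by lra.
have C0 : (0 <= C)%R by rewrite mulr_ge0 ?divr_ge0//; lra.
(* The first bound keeps [s * a / (2 - s)] at or below [a']; the second keeps the total cost
   [e * (3 / 2 * P + C)] within the gap [P / 2 - Q]. *)
pose e := Num.min ((a' - a) / (a' + a))%R ((P / 2 - Q) / (3 / 2 * P + C))%R.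
have e0 : (0 < e)%R by rewrite lt_min !divr_gt0//; lra.
have e1 : (e * (a' + a) <= a' - a)%R.
  by rewrite -ler_pdivlMr ?ge_min ?lexx//; lra.
have e2 : (e * (3 / 2 * P + C) <= P / 2 - Q)%R.
  by rewrite -ler_pdivlMr ?ge_min ?lexx ?orbT//; lra.
have lt1 : (e < 1)%R.
  by rewrite gt_min; apply/orP; left; rewrite ltr_pdivrMr ?mul1r; lra.
pose s := (1 + e)%R.
have s12 : (1 < s < 2)%R by rewrite /s; lra.
(* The weight of [a'] when [s * a / (2 - s)] is written as a convex combination of [a'] and [a]. *)
pose t := (2 * a * e / ((1 - e) * (a' - a)))%R.
have t01 : (0 <= t <= 1)%R.
  have D0 : (0 < (1 - e) * (a' - a))%R by rewrite mulr_gt0//; lra.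
  rewrite /t divr_ge0 ?(ltW D0) ?mulr_ge0 ?(ltW e0) ?(ltW a0)//=.
  by rewrite ler_pdivrMr// mul1r; lra.
have phis : phi (s * a / (2 - s))%R <= (P + t * (M - P))%:E.
  have -> : (s * a / (2 - s) = t * a' + (1 - t) * a)%R.
    by rewrite /s /t; field; rewrite !gt_eqF//; lra.
  have := orlicz_convex phiO (ltW (lt_trans a0 aa')) (ltW a0) t01.
  rewrite ME PE -!EFinM -EFinD => /le_trans; apply.
  by rewrite lee_fin; lra.
exists s; split => //; first exact: le_lt_trans phis (ltry _).
apply: (@le_trans _ _ (s%:E * P%:E + ((2 - s)%:E * Q%:E + (s - 1)%:E * P%:E +
    (1 - s / 2)%:E * (P + t * (M - P))%:E))).
  rewrite leeD2l// leeD//.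
    by rewrite -QE -PE orlicz_dilate_half_le//; lra.
  by rewrite lee_wpmul2l// lee_fin; lra.
rewrite -!EFinM -!EFinD -?EFinM lee_fin.
have tE : ((1 - s / 2) * t * (M - P) = e * C)%R.
  by rewrite /s /t /C; field; rewrite !gt_eqF//; lra.
have -> : ((1 - s / 2) * (P + t * (M - P)) = (1 - s / 2) * P + e * C)%R.
  by rewrite -tE; ring.
have : (0 <= e * Q)%R by rewrite mulr_ge0// ltW.
by rewrite /s; lra.
Qed.

End dilation.

(** * Modulars and Luxemburg norms of multiples of indicators *)

Section modular_theory.
Context d (T : measurableType d) (R : realType).
Variables (mu : {measure set T -> \bar R}) (phi : R -> \bar R).
Hypothesis phiO : orlicz_function phi.

Lemma measurable_orlicz (f : T -> R) : measurable_fun setT f ->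
  measurable_fun setT (fun t => phi `|f t|%R).
Proof. by move=> mf; exact: measurableT_comp (measurable_orlicz_norm phiO) mf. Qed.

Lemma measurable_cst_indic (c : R) (A : set T) : measurable A ->
  measurable_fun setT (fun t => c * \1_A t)%R.
Proof. by move=> mA; apply: measurable_funM => //; exact: measurable_indic. Qed.

Lemma modular_cst_indic (c : R) (A : set T) : (0 <= c)%R -> measurable A ->
  modular mu phi (fun t => c * \1_A t)%R = phi c * mu A.
Proof.
move=> c0 mA; rewrite -[in RHS](setIT A) -integral_indic//.
rewrite -ge0_integralZl//; last 2 first.
- by apply/measurable_EFinP; exact: measurable_indic.
- by apply: orlicz_ge0.
apply: eq_integral => t _; rewrite indicE; case: (t \in A).
  by rewrite mulr1 mule1 ger0_norm.
by rewrite mulr0 mule0 normr0 (orlicz_at0 phiO).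
Qed.

Lemma ge0_integral_le_modular (h : T -> \bar R) (y : T -> R) (k c : R) (A : set T) :
  (0 <= k)%R -> (0 <= c)%R -> measurable A -> measurable_fun setT y ->
  measurable_fun setT h -> (forall t, 0 <= h t) ->
  (forall t, h t <= k%:E * phi `|y t|%R + c%:E * (\1_A t)%:E) ->
  \int[mu]_t h t <= k%:E * modular mu phi y + c%:E * mu A.
Proof.
move=> k0 c0 mA my mh h0 hle.
have phi0 t : 0 <= phi `|y t|%R by exact: orlicz_ge0.
have ind0 t : 0 <= (\1_A t)%:E :> \bar R by rewrite lee_fin indicE ler0n.
have mind : measurable_fun setT (fun t => (\1_A t)%:E : \bar R).
  by apply/measurable_EFinP; exact: measurable_indic.
have mphi := measurable_orlicz my.
rewrite -[in leRHS](setIT A) -integral_indic// /modular.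
rewrite -!ge0_integralZl_EFin// -ge0_integralD//; last 4 first.
- by move=> t _; rewrite mule_ge0.
- exact: measurable_funeM.
- by move=> t _; rewrite mule_ge0.
- exact: measurable_funeM.
apply: ge0_le_integral => //.
by apply: emeasurable_funD; exact: measurable_funeM.
Qed.

Lemma luxemburg_le (f : T -> R) (e : R) : (0 < e)%R ->
  modular mu phi (fun t => f t / e)%R <= 1 -> luxemburg mu phi f <= e%:E.
Proof. by move=> e0 fe; apply: ereal_inf_lbound; exists e. Qed.

Lemma luxemburg_ge0 (f : T -> R) : 0 <= luxemburg mu phi f.
Proof. by apply: le_ereal_inf_tmp => _ [e [e0 _] <-]; rewrite lee_fin ltW. Qed.

(** For [e < 1] convexity gives [phi (a / e) * mu A >= e^-1 > 1], so no smaller [e] is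
    admissible. *)
Lemma luxemburg_cst_indic (a : R) (A : set T) : (0 <= a)%R -> measurable A ->
  phi a * mu A = 1 -> luxemburg mu phi (fun t => a * \1_A t)%R = 1.
Proof.
move=> a0 mA phiA; apply/eqP; rewrite eq_le; apply/andP; split.
  apply: luxemburg_le => //; under [X in modular mu phi X]eq_fun do rewrite divr1.
  by rewrite modular_cst_indic// phiA.
apply: le_ereal_inf_tmp => _ [e [e0 Ie] <-]; rewrite lee_fin leNgt.
apply/negP => e1; move: Ie; under [X in modular mu phi X]eq_fun do rewrite mulrAC.
rewrite modular_cst_indic ?(divr_ge0 a0 (ltW e0))// leNgt => /negP; apply.
have ie : (1 < e^-1)%R by rewrite invf_gt1.
apply: (@lt_le_trans _ _ (e^-1%:E * (phi a * mu A))).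
  by rewrite phiA mule1 lte_fin.
rewrite muleA lee_wpmul2r// [(a / e)%R]mulrC.
by apply: orlicz_scale_ge => //; exact: ltW.
Qed.

Lemma orlicz_space_cst_indic (a : R) (A : set T) : (0 <= a)%R -> measurable A ->
  phi a * mu A = 1 -> orlicz_space mu phi (fun t => a * \1_A t)%R.
Proof.
move=> a0 mA phiA; split; first exact: measurable_cst_indic.
exists 1%R => //; under [X in modular mu phi X]eq_fun do rewrite mul1r.
by rewrite modular_cst_indic// phiA ltry.
Qed.

(* Since [luxemburg y = 1], [y / e] has modular at most 1 for some [e] just above 1;
   the dilation factor [s] of the hypothesis absorbs both [e] and [delta]. *)
Lemma uniformly_non_l12_cst_indic (a s : R) (A : set T) :
  (0 <= a)%R -> measurable A -> phi a * mu A = 1 -> (1 < s)%R ->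
  (forall (p : R) (y : T -> R), (0 <= p <= a)%R -> measurable_fun setT y ->
    modular mu phi y <= 1 ->
    modular mu phi (fun t => s / 2 * (p * \1_A t + y t))%R <= 1 \/
    modular mu phi (fun t => s / 2 * (p * \1_A t - y t))%R <= 1) ->
  uniformly_non_l12_point (orlicz_space mu phi) (luxemburg mu phi)
    (fun t => a * \1_A t)%R.
Proof.
move=> a0 mA phiA s1 H; split.
- exact: orlicz_space_cst_indic.
- exact: luxemburg_cst_indic.
(* For [e < (1 + s) / 2] the norm obtained below is at most [2 / s * e < (1 + s) / s = 2 - (s - 1) /
   s]. *)
exists ((s - 1) / s)%R; first by rewrite divr_gt0//; lra.
move=> y [my _] y1.
have : luxemburg mu phi y < ((1 + s) / 2)%:E by rewrite y1 lte_fin; lra.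
move=> /ereal_inf_lt[_ [e [e0 Ie] <-]]; rewrite lte_fin => es.
have e1 : (1 <= e)%R by rewrite -lee_fin -y1 luxemburg_le.
(* Dividing [x + y] by [e] also lowers the height of [x] to [a / e], which is why the hypothesis
   ranges over all [p] up to [a]. *)
have pa : (0 <= a / e <= a)%R.
  by rewrite divr_ge0 ?(ltW e0)//= ler_pdivrMr// ler_peMr.
have mye : measurable_fun setT (fun t => y t / e)%R by exact: measurable_funM.
have c0 : (0 < 2 / s * e)%R by rewrite mulr_gt0// divr_gt0//; lra.
have le : ((2 / s * e)%:E <= (2 - (s - 1) / s)%:E :> \bar R).
  rewrite lee_fin; have -> : (2 - (s - 1) / s = 2 / s * ((1 + s) / 2))%R by field; lra.
  by rewrite ler_wpM2l ?(ltW es)// divr_ge0//; lra.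
rewrite ge_min; apply/orP.
have [h|h] := H _ _ pa mye Ie; [left|right]; apply: le_trans le;
  apply: luxemburg_le => //; apply: le_trans h; rewrite le_eqVlt; apply/orP;
  left; apply/eqP; congr modular; apply/funext => t /=.
- by rewrite -[(_ + y)%R t]/(a * \1_A t + y t)%R; field; rewrite !gt_eqF//; lra.
- by rewrite -[(_ - y)%R t]/(a * \1_A t - y t)%R; field; rewrite !gt_eqF//; lra.
Qed.

End modular_theory.

(** * Modulars of sums and differences, and the two non-[l12] criteria *)

Section non_l12_indicator.
Context d (T : measurableType d) (R : realType).
Variables (mu : {measure set T -> \bar R}) (phi : R -> \bar R).
Hypothesis phiO : orlicz_function phi.

Lemma modularN (y : T -> R) : modular mu phi (fun t => - y t)%R = modular mu phi y.
Proof. by apply: eq_integral => t _; rewrite normrN. Qed.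

Let measurable_dilation (s p : R) (y : T -> R) (A : set T) : measurable A ->
  measurable_fun setT y ->
  measurable_fun setT (fun t => s / 2 * (p * \1_A t + y t))%R.
Proof.
move=> mA my; apply: measurable_funM => //; apply: measurable_funD => //.
exact: measurable_cst_indic.
Qed.

Let orlicz_off (s v : R) : (0 <= s <= 2)%R ->
  phi (s / 2 * `|v|)%R <= (s / 2)%:E * phi `|v|%R.
Proof. by move=> s2; apply: orlicz_scale_le => //; lra. Qed.

(** On [A] the sign of [y] turns the integrand into the one of [orlicz_diff_le]; off [A] only [y]
    remains, scaled by [s / 2 <= 1]. *)
Lemma modular_diff_le (s a p c : R) (y : T -> R) (A : set T) :
  (0 <= s <= 2)%R -> (0 <= p <= a)%R -> phi (s / 2 * a)%R = c%:E ->
  measurable A -> measurable_fun setT y -> (forall t, A t -> (0 <= y t)%R) ->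
  modular mu phi (fun t => s / 2 * (p * \1_A t - y t))%R <=
  (s / 2)%:E * modular mu phi y + c%:E * mu A.
Proof.
move=> s2 pa phic mA my y0; have [s0 _] := andP s2.
have h0 : (0 <= s / 2)%R by lra.
have a0 : (0 <= a)%R by lra.
apply: ge0_integral_le_modular => //.
- by rewrite -lee_fin -phic; apply: orlicz_ge0 => //; rewrite mulr_ge0.
- apply: measurable_orlicz => //; apply: measurable_dilation => //.
  exact: measurableT_comp.
- by move=> t; exact: orlicz_ge0.
move=> t; rewrite normrM (ger0_norm h0) indicE.
case: (boolP (t \in A)) => [/set_mem At|_] /=.
  rewrite mulr1 mule1 -phic (ger0_norm (y0 _ At)).
  by apply: orlicz_diff_le => //; exact: y0.
by rewrite mulr0 mule0 adde0 sub0r normrN; exact: orlicz_off.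
Qed.

(** With [v] the absolute value of [y], the two absolute values on [A] are [p + v] and [|p - v|] in
    some order, so both pointwise estimates apply to their sum. Off [A] each modular contributes
    [s / 2 * phi v]. *)
Lemma modular_sum_diff_le (s a p c c' : R) (y : T -> R) (A : set T) :
  (0 <= s < 2)%R -> (0 <= p <= a)%R -> phi (s / 2 * a)%R = c%:E ->
  phi (s * a / (2 - s))%R = c'%:E -> measurable A -> measurable_fun setT y ->
  modular mu phi (fun t => s / 2 * (p * \1_A t + y t))%R +
  modular mu phi (fun t => s / 2 * (p * \1_A t - y t))%R <=
  s%:E * modular mu phi y + (c + (1 - s / 2) * c')%:E * mu A.
Proof.
move=> s2 pa phic phic' mA my; have [s0 _] := andP s2.
have s2' : (0 <= s <= 2)%R by lra.
have h0 : (0 <= s / 2)%R by lra.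
have a0 : (0 <= a)%R by lra.
have c0 : (0 <= c)%R.
  by rewrite -lee_fin -phic; apply: orlicz_ge0 => //; rewrite mulr_ge0.
have c'0 : (0 <= c')%R.
  rewrite -lee_fin -phic'; apply: orlicz_ge0 => //.
  by rewrite divr_ge0 ?mulr_ge0//; lra.
have mp : measurable_fun setT (fun t => phi `|s / 2 * (p * \1_A t + y t)|%R).
  by apply: measurable_orlicz => //; exact: measurable_dilation.
have mm : measurable_fun setT (fun t => phi `|s / 2 * (p * \1_A t - y t)|%R).
  apply: measurable_orlicz => //; apply: measurable_dilation => //.
  exact: measurableT_comp.
rewrite /modular -ge0_integralD//; last 2 first.
- by move=> t _; exact: orlicz_ge0.
- by move=> t _; exact: orlicz_ge0.
apply: ge0_integral_le_modular => //.
- by rewrite addr_ge0// mulr_ge0//; lra.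
- exact: emeasurable_funD.
- by move=> t; rewrite adde_ge0//; exact: orlicz_ge0.
have splitE v : 0 <= v -> (s / 2)%:E * v + (s / 2)%:E * v = s%:E * v.
  by move=> v0; rewrite -ge0_muleDl ?lee_fin// -EFinD; congr (_%:E * _); lra.
have key v : (0 <= v)%R -> phi (s / 2 * (p + v))%R + phi (s / 2 * `|p - v|)%R <=
    s%:E * phi v + (c + (1 - s / 2) * c')%:E.
  move=> v0; apply: le_trans.
    exact: (leeD (orlicz_sum_le phiO s2 v0 pa) (orlicz_diff_le phiO s2' v0 pa)).
  rewrite phic phic' addeACA splitE ?(orlicz_ge0 phiO v0)//.
  by rewrite -EFinM -EFinD [(c + _)%R]addrC.
have nrm u : (`|s / 2 * u| = s / 2 * `|u|)%R by rewrite normrM (ger0_norm h0).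
move=> t; rewrite !nrm indicE.
case: (boolP (t \in A)) => _ /=.
  rewrite mulr1 mule1; have [yt0|yt0] := leP 0%R (y t).
    by rewrite (ger0_norm yt0) [X in phi (_ * X)%R + _]ger0_norm; [exact: key|lra].
  (* For negative [y t] the sum and the difference exchange roles. *)
  rewrite addeC.
  rewrite [X in phi (_ * X)%R + _]ger0_norm; last by lra.
  have := key `|y t|%R (normr_ge0 _).
  by rewrite (ltr0_norm yt0) opprK.
rewrite mulr0 mule0 adde0 add0r sub0r normrN -splitE ?orlicz_ge0//.
by rewrite leeD// orlicz_off.
Qed.

(** The first hypothesis carries the atomicity of [A]: as [y] keeps one sign there, either [x - y]
    or [x + y] has absolute value [|a - v|] on all of [A], and [modular_diff_le] controls it. *)
Lemma uniformly_non_l12_atom (a : R) (A : set T) :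
  (forall y : T -> R, (forall t, A t -> (0 <= y t)%R) \/
                      (forall t, A t -> (y t <= 0)%R)) ->
  (0 <= a)%R -> measurable A -> phi a = 1 -> mu A = 1 -> orlicz_d phi < a%:E ->
  uniformly_non_l12_point (orlicz_space mu phi) (luxemburg mu phi)
    (fun t => a * \1_A t)%R.
Proof.
move=> sgnA a0 mA phia muA da.
have [s s12] := exists_dilation_atom phiO a0 da phia.
have s2 : (0 <= s <= 2)%R by lra.
have fin : phi (s / 2 * a)%R \is a fin_num.
  apply: (orlicz_fin_num phiO (v := a)); last by rewrite phia ltry.
    by rewrite mulr_ge0//; lra.
  by rewrite ler_piMl//; lra.
case phic : (phi (s / 2 * a)%R) fin => [c| |]// _ sc.
have main (p : R) (y : T -> R) : (0 <= p <= a)%R -> measurable_fun setT y ->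
    modular mu phi y <= 1 -> (forall t, A t -> (0 <= y t)%R) ->
    modular mu phi (fun t => s / 2 * (p * \1_A t - y t))%R <= 1.
  move=> pa my y1 y0.
  apply: le_trans (modular_diff_le s2 pa phic mA my y0) _.
  rewrite muA mule1; apply: le_trans sc; rewrite leeD2r//.
  by rewrite -[leRHS]mule1 lee_wpmul2l// lee_fin; lra.
apply: (@uniformly_non_l12_cst_indic _ _ _ mu phi phiO a s) => //.
- by rewrite phia muA mule1.
- by lra.
move=> p y pa my y1; have [y0|y0] := sgnA y.
  by right; exact: main.
left; have -> : (fun t => s / 2 * (p * \1_A t + y t))%R =
    (fun t => s / 2 * (p * \1_A t - - y t))%R by apply/funext => t; rewrite opprK.
apply: (main p (fun t => - y t)%R) => //; first exact: measurableT_comp.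
  by rewrite modularN.
by move=> t /y0; rewrite oppr_ge0.
Qed.

(** The choice of [s] and [phi a * mu A = 1] bound the sum of the two dilated modulars by 2, so they
    cannot both exceed 1. *)
Lemma uniformly_non_l12_interior (a a' : R) (A : set T) :
  (0 < a)%R -> measurable A -> phi a * mu A = 1 -> orlicz_d phi < a%:E ->
  (a < a')%R -> phi a' < +oo ->
  uniformly_non_l12_point (orlicz_space mu phi) (luxemburg mu phi)
    (fun t => a * \1_A t)%R.
Proof.
move=> a0 mA phiA da aa' phia'.
have phia0 : 0 <= phi a by apply: orlicz_ge0 => //; exact: ltW.
have phia_gt0 : 0 < phi a.
  rewrite lt_neqAle phia0 andbT eq_sym; apply/eqP => phia.
  by have : 0 < 1 :> \bar R; [exact: lte01|rewrite -phiA phia mul0e ltxx].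
have [s [s12 phis]] := exists_dilation phiO a0 da aa' phia' phia_gt0.
have s2 : (0 <= s < 2)%R by lra.
have finP : phi a \is a fin_num.
  by apply: (orlicz_fin_num phiO (v := a')) => //; exact: ltW.
have finc : phi (s / 2 * a)%R \is a fin_num.
  apply: (orlicz_fin_num phiO (v := a')) => //.
    by rewrite mulr_ge0//; lra.
  by apply: le_trans (ltW aa'); rewrite ler_piMl//; lra.
have finc' : phi (s * a / (2 - s))%R \is a fin_num.
  by apply: (orlicz_fin_num phiO _ (lexx _)) => //; rewrite divr_ge0 ?mulr_ge0//; lra.
case phic : (phi (s / 2 * a)%R) finc => [c| |]// _.
case phic' : (phi (s * a / (2 - s))%R) finc' => [c'| |]// _.
move: phiA; case PE : (phi a) finP => [P| |]// _ phiA.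
rewrite -!EFinM -!EFinD lee_fin => sc.
apply: (@uniformly_non_l12_cst_indic _ _ _ mu phi phiO a s) => //.
- exact: ltW.
- by rewrite PE.
- by lra.
move=> p y pa my y1.
have := modular_sum_diff_le s2 pa phic phic' mA my.
set I := modular _ _ _; set J := modular _ _ _; move=> IJ.
have {}IJ : I + J <= 2%:E.
  apply: le_trans IJ _.
  apply: (@le_trans _ _ (s%:E * (P%:E * mu A) + (c + (1 - s / 2) * c')%:E * mu A)).
    by rewrite leeD2r// phiA lee_wpmul2l// lee_fin; lra.
  have c0 : (0 <= c + (1 - s / 2) * c')%R.
    rewrite addr_ge0//.
      by rewrite -lee_fin -phic; apply: orlicz_ge0 => //; rewrite mulr_ge0//; lra.
    rewrite mulr_ge0//; first lra.
    rewrite -lee_fin -phic'; apply: orlicz_ge0 => //.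
    by rewrite divr_ge0 ?mulr_ge0//; lra.
  have P0 : (0 <= P)%R by rewrite -lee_fin -PE.
  rewrite muleA -EFinM -ge0_muleDl ?lee_fin//; last by rewrite mulr_ge0//; lra.
  rewrite -EFinD -[leRHS]mule1 -phiA muleA -EFinM.
  by rewrite lee_wpmul2r// lee_fin.
have [I1|I1] := leP I 1; [by left|right].
rewrite leNgt; apply/negP => J1.
move: IJ; rewrite leNgt => /negP; apply.
have -> : 2%:E = 1 + 1 :> \bar R by rewrite -EFinD.
by apply: lteD.
Qed.

End non_l12_indicator.

(** * Order continuity of multiples of indicators *)

Section order_continuity.
Context d (T : measurableType d) (R : realType).
Variables (mu : {measure set T -> \bar R}) (phi : R -> \bar R).
Hypothesis phiO : orlicz_function phi.

Lemma luxemburg_ae_le (f g : T -> R) :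
  measurable_fun setT f -> measurable_fun setT g ->
  {ae mu, forall t, (`|f t| <= `|g t|)%R} ->
  luxemburg mu phi f <= luxemburg mu phi g.
Proof.
move=> mf mg fg; apply: ereal_inf_le_tmp => _ [e [e0 Ie] <-]; exists e => //.
split => //; apply: le_trans Ie; apply: ae_ge0_le_integral => //.
- by move=> t _; exact: orlicz_ge0.
- by apply: measurable_orlicz => //; exact: measurable_funM.
- by move=> t _; exact: orlicz_ge0.
- by apply: measurable_orlicz => //; exact: measurable_funM.
apply: filterS fg => t fgt _; apply: orlicz_le => //.
by rewrite !normrM ler_wpM2r.
Qed.

(** Once [|u n| <= 1], convexity gives [phi |u n| <= |u n| * phi 1]. *)
Lemma orlicz_cvg0 (u : R^nat) : (forall v, (0 <= v)%R -> phi v < +oo) ->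
  u n @[n --> \oo] --> 0%R -> phi `|u n|%R @[n --> \oo] --> 0.
Proof.
move=> phi_lty u0.
have : phi 1%R \is a fin_num by rewrite (orlicz_fin_num phiO _ (lexx _))// phi_lty.
case phi1 : (phi 1%R) => [M| |]// _.
apply: (@squeeze_cvge _ _ _ _ (cst 0) _ (fun n => (`|u n| * M)%:E)).
- near=> n; rewrite orlicz_ge0//= EFinM -phi1.
  rewrite -[X in phi X]mulr1; apply: orlicz_scale_le => //; rewrite normr_ge0/=.
  by near: n; exact: cvgr0_norm_le.
- exact: cvg_cst.
- apply: cvg_EFin; first by near=> n.
  rewrite -[X in _ --> X](mul0r M) -(normr0 R).
  by apply: cvgM; [exact: cvg_norm|exact: cvg_cst].
Unshelve. all: by end_near. Qed.

(** For each [e > 0] the functions [phi (f_ n / e)] are dominated by the integrable [phi (a / e)] on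
    [A], so their integrals tend to 0 and some norm is at most [e]. *)
Lemma order_continuous_cst_indic (a : R) (A : set T) : (0 <= a)%R ->
  measurable A -> mu A < +oo -> (forall v, (0 <= v)%R -> phi v < +oo) ->
  orlicz_space mu phi (fun t => a * \1_A t)%R ->
  order_continuous mu phi (fun t => a * \1_A t)%R.
Proof.
move=> a0 mA muA phi_lty xX; split => // f_ mf f0 fni fcvg.
have ni : nonincreasing_seq (fun n => luxemburg mu phi (f_ n)).
  move=> n m nm; apply: luxemburg_ae_le => //.
  apply: filterS2 (f0 m) fni => t /andP[fm0 _] /(_ _ _ nm) fmn.
  by rewrite !ger0_norm// (le_trans fm0).
split => //.
(* The norms decrease to their infimum, so one index per [e] suffices. *)
rewrite [X in _ --> X](_ : 0 = ereal_inf (range (fun n => luxemburg mu phi (f_ n)))).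
  exact: ereal_nonincreasing_cvgn.
apply/eqP; rewrite eq_le; apply/andP; split.
  by apply: le_ereal_inf_tmp => _ [n _ <-]; exact: luxemburg_ge0.
apply/lee_addgt0Pr => e e0; rewrite add0e.
suff [n In] : exists n, modular mu phi (fun t => f_ n t / e)%R <= 1.
  apply: ge_ereal_inf; exists (luxemburg mu phi (f_ n)); first by exists n.
  exact: luxemburg_le.
apply: contrapT => /forallNP In.
have ae0 : (0 <= a / e)%R by rewrite divr_ge0// ltW.
have fin : phi (a / e)%R \is a fin_num.
  by rewrite (orlicz_fin_num phiO _ (lexx _))// phi_lty.
case phiae : (phi (a / e)%R) fin => [K| |]// _.
have mfe n : measurable_fun setT (fun t => phi `|f_ n t / e|%R).
  by apply: measurable_orlicz => //; exact: measurable_funM.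
have [||||_ _] := @dominated_convergence _ T R mu setT measurableT
  (fun n t => phi `|f_ n t / e|%R) (cst 0) (fun t => K%:E * (\1_A t)%:E) mfe.
- exact: measurable_cst.
- apply: filterS fcvg => t ft _; apply: orlicz_cvg0 => //.
  by rewrite -(mul0r (e^-1)%R); apply: cvgM => //; exact: cvg_cst.
- apply: integrableZl => //; apply/integrableP; split.
    by apply/measurable_EFinP; exact: measurable_indic.
  under eq_integral do rewrite gee0_abs ?lee_fin ?indicE ?ler0n//.
  under eq_integral do rewrite -indicE.
  by rewrite integral_indic// setIT.
- apply: filterS (ae_foralln f0) => t ft n _.
  rewrite gee0_abs ?orlicz_ge0//; have := ft n.
  rewrite indicE; case: (t \in A) => /andP[fn0].
    rewrite mulr1 (ger0_norm a0) mule1 -phiae => fna; apply: orlicz_le => //.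
    by rewrite ger0_norm ?divr_ge0 ?(ltW e0)// ler_wpM2r// invr_ge0 ltW.
  rewrite mulr0 normr0 => fn00; have -> : f_ n t = 0%R by apply/eqP; rewrite eq_le fn00.
  by rewrite mul0r normr0 (orlicz_at0 phiO) mule0.
rewrite integral0 => I0; have : 1 <= 0 :> \bar R.
  apply: (cvge_to_ge I0); apply: nearW => n.
  by rewrite ltW// ltNge; apply/negP; exact: In.
by rewrite leNgt lte01.
Qed.

End order_continuity.

(** * Values taken by a nonatomic measure *)

Section nonatomic_range.
Context d (T : measurableType d) (R : realType).
Variable mu : {measure set T -> \bar R}.
Hypothesis mu_na : nonatomic mu.

(** Nonatomicity splits [A] into two pieces of positive measure, the first one finite; the smaller
    piece has at most half the measure. *)
Lemma nonatomic_half (A : set T) : measurable A -> 0 < mu A ->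
  exists B (r : R), [/\ measurable B, B `<=` A, mu B = r%:E, (0 < r)%R &
    (2 * r)%:E <= mu A].
Proof.
move=> mA A0; have [B [mB BA B0 Blt]] := mu_na mA A0.
have muD : mu B + mu (A `\` B) = mu A.
  rewrite -measureU//; first by rewrite setDUK.
  - exact: measurableD.
  - by rewrite setDIK.
have D0 : 0 <= mu (A `\` B) by exact: measure_ge0.
case BE : (mu B) B0 Blt muD => [b| |]//; rewrite ?ltNge ?leey//.
rewrite -!ltNge => b0 Blt.
case DE : (mu (A `\` B)) D0 => [c| |]// c0; last first.
  by move=> muA; exists B, b; split => //; rewrite -muA addey// leey.
move=> muA; move: Blt; rewrite -muA -EFinD !lte_fin => bc.
have [bc'|cb] := leP b c.
  by exists B, b; split => //; rewrite lee_fin; lra.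
exists (A `\` B), c; split => //; first exact: measurableD.
  by lra.
by rewrite lee_fin; lra.
Qed.

Lemma nonatomic_small (A : set T) (e : R) : measurable A -> 0 < mu A ->
  (0 < e)%R -> exists B (r : R), [/\ measurable B, B `<=` A, mu B = r%:E &
    (0 < r <= e)%R].
Proof.
move=> mA A0 e0.
have [A' [r0 [mA' A'A A'E r00 _]]] := nonatomic_half mA A0.
(* Repeated halving; the linear rate, from [n.+2 <= 2 * n.+1], is enough for the Archimedean choice
   of [n]. *)
have small n : exists B (r : R), [/\ measurable B, B `<=` A', mu B = r%:E,
    (0 < r)%R & (n.+1%:R * r <= r0)%R].
  elim: n => [|n [B [r [mB BA BE r_gt0 rn]]]].
    by exists A', r0; split => //; rewrite mul1r.
  have B0 : 0 < mu B by rewrite BE lte_fin.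
  have [C [q [mC CB CE q0]]] := nonatomic_half mB B0; rewrite BE lee_fin => qr.
  exists C, q; split => //; first exact: subset_trans BA.
  apply: le_trans rn; apply: (@le_trans _ _ (n.+1%:R * (2 * q))%R).
    rewrite mulrA ler_pM2r// -natrM ler_nat muln2 -addnn addSn addnS ltnS ltnS.
    by rewrite leq_addr.
  by rewrite ler_pM2l.
have [B [r [mB BA BE r_gt0 rn]]] := small (Num.truncn (r0 / e)).
exists B, r; split => //; first exact: subset_trans A'A.
rewrite r_gt0/= leNgt; apply/negP => er.
have : (r0 / e < (Num.truncn (r0 / e)).+1%:R)%R.
  by rewrite truncnS_gt.
rewrite ltr_pdivrMr// => h.
have : ((Num.truncn (r0 / e)).+1%:R * e < (Num.truncn (r0 / e)).+1%:R * r)%R.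
  by rewrite ltr_pM2l.
by lra.
Qed.

(* Sierpinski: exhaust greedily below level [t]; a deficit in the limit could
   be reduced by a small set in the complement, against the greedy choice. *)
Lemma nonatomic_measure_eq (t : R) : (0 <= t)%R -> t%:E <= mu setT ->
  exists2 A, measurable A & mu A = t%:E.
Proof.
move=> t0 tT; pose S := [set A | measurable A /\ mu A <= t%:E].
have step (nA : nat * set T) : exists B, S nA.2 ->
    [/\ S B, nA.2 `<=` B & forall C, S C -> nA.2 `<=` C ->
      mu C <= mu B + (nA.1.+1%:R^-1)%:E].
  case: nA => n A /=; have [SA|nSA] := pselect (S A); last by exists A.
  pose E := [set mu C | C in [set C | S C /\ A `<=` C]].
  have AE : E (mu A) by exists A => //; split.
  have Efin : ereal_sup E \is a fin_num.
    rewrite ge0_fin_numE; last exact: le_trans (measure_ge0 mu A) (ereal_sup_ubound AE).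
    apply: (@le_lt_trans _ _ t%:E); last exact: ltry.
    by apply: ge_ereal_sup => _ [C [[_ Ct] _] <-].
  have n0 : (0 < n.+1%:R^-1 :> R)%R by rewrite invr_gt0.
  have [_ [B [SB AB] <-] supB] := ub_ereal_sup_adherent n0 Efin.
  exists B => _; split => // C SC AC.
  rewrite -leeBlDr//; apply: le_trans (ltW supB).
  by rewrite leeD2r// ereal_sup_ubound//; exists C.
have [f fP] := choice step.
pose F := nat_rect (fun _ => set T) set0 (fun n A => f (n, A)).
have SF n : S (F n).
  elim: n => [|n IHn]; first by split => //=; rewrite measure0 lee_fin.
  by have [] := fP (n, F n) IHn.
have FS n : F n `<=` F n.+1 by have [] := fP (n, F n) (SF n).
have Fmax n C : S C -> F n `<=` C -> mu C <= mu (F n.+1) + (n.+1%:R^-1)%:E.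
  by have [_ _] := fP (n, F n) (SF n); exact.
have ndF : nondecreasing_seq F.
  by apply/nondecreasing_seqP => n; apply/subsetPset; exact: FS.
have mF n : measurable (F n) by have [] := SF n.
pose U := \bigcup_n F n.
have mU : measurable U by exact: bigcup_measurable.
have FU n : F n `<=` U by exact: bigcup_sup.
have Ut : mu U <= t%:E.
  have cvgF : mu (F n) @[n --> \oo] --> mu U by exact: nondecreasing_cvg_mu.
  apply: cvge_to_le cvgF _; apply: nearW => n /=; by have [] := SF n.
exists U => //; apply/eqP; rewrite eq_le Ut /= leNgt; apply/negP => Ult.
have mUC : measurable (~` U) by exact: measurableC.
have UC0 : 0 < mu (~` U).
  rewrite lt_def measure_ge0 andbT; apply/eqP => UC0.
  have muT : mu setT = mu U + mu (~` U) by rewrite -measureU ?setICr// setUv.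
  by move: tT; rewrite muT UC0 adde0 leNgt Ult.
have : mu U \is a fin_num by rewrite ge0_fin_numE ?measure_ge0// (le_lt_trans Ut) ?ltry.
case UE : (mu U) => [u| |]// _; move: Ult; rewrite UE lte_fin => ut.
have tu : (0 < t - u)%R by lra.
have [B [r [mB BU BE /andP[r0 rtu]]]] := nonatomic_small mUC UC0 tu.
have UBE : mu (U `|` B) = (u + r)%:E.
  rewrite EFinD -UE -BE measureU//.
  apply/seteqP; split => // x [Ux Bx].
  by have := BU _ Bx; exact.
have SUB : S (U `|` B).
  by split; [exact: measurableU|rewrite UBE lee_fin; lra].
(* This makes [1 / (n + 1) < r]. But [U] with [B] added is an admissible superset of [F n], so
   greediness would give [u + r <= u + 1 / (n + 1)]. *)
pose n := Num.truncn r^-1.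
have := Fmax n _ SUB (subset_trans (FU n) (@subsetUl _ _ _)).
rewrite UBE leNgt => /negP; apply.
apply: (@le_lt_trans _ _ (mu U + (n.+1%:R^-1)%:E)).
  by rewrite leeD2r// le_measure ?inE.
rewrite UE -EFinD lte_fin ltrD2l invf_plt ?posrE//.
by rewrite truncnS_gt.
Qed.

End nonatomic_range.

(** * Choice of the height [a] *)

Section orlicz_levels.
Context (R : realType) (phi : R -> \bar R).
Hypothesis phiO : orlicz_function phi.

Lemma lt_orlicz_b (u : R) : u%:E < orlicz_b phi ->
  exists2 v, (u < v)%R & phi v < +oo.
Proof.
by move=> /ereal_sup_gt[_ [v [_ phiv] <-]]; rewrite lte_fin; exists v.
Qed.

Lemma lt_orlicz_b_lty (u : R) : (0 <= u)%R -> u%:E < orlicz_b phi -> phi u < +oo.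
Proof.
move=> u0 /lt_orlicz_b[v uv phiv].
by rewrite (le_lt_trans _ phiv)// (orlicz_le phiO)// ltW.
Qed.

(** If [phi a] were 0, then [phi] would be linear with slope 0 on [[0, a]]. *)
Lemma orlicz_d_lt_gt0 (a : R) : orlicz_d phi < a%:E -> 0 < phi a.
Proof.
move=> da; have a0 : (0 < a)%R by rewrite -lte_fin (le_lt_trans (orlicz_d_ge0 phiO)).
rewrite lt_def (orlicz_ge0 phiO (ltW a0)) andbT; apply/eqP => phia.
move: da; rewrite ltNge => /negP; apply; apply: ereal_sup_ubound; exists a => //.
split; first exact: ltW.
exists 0%R => // v /andP[v0 va]; rewrite mul0r; apply/eqP.
by rewrite eq_le (orlicz_ge0 phiO v0) andbT (le_trans (orlicz_le phiO v0 va)) ?phia.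
Qed.

(** For finite [b], left continuity carries [k < phi b] to points just below [b]; for infinite [b],
    unboundedness of [phi] is enough. *)
Lemma exists_orlicz_level (k : R) : orlicz_d phi < orlicz_b phi ->
  (forall b, orlicz_b phi = b%:E -> k%:E < phi b) ->
  exists a, [/\ orlicz_d phi < a%:E, a%:E < orlicz_b phi & k%:E < phi a].
Proof.
move=> db kb; have := orlicz_d_ge0 phiO; move: db.
case: (orlicz_d phi) => [D| |]//; last by rewrite ltNge leey.
case bE : (orlicz_b phi) => [b| |]// Db; rewrite ?lee_fin => D0.
  rewrite lte_fin in Db; have b0 : (0 < b)%R by lra.
  apply: contrapT => /forallNP nolevel.
  have := kb _ bE; rewrite ltNge => /negP; apply.
  apply: cvge_to_le (orlicz_left_continuous phiO b0) _; near=> x.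
  rewrite leNgt; apply/negP => kx; apply: (nolevel x).
  by split => //; rewrite lte_fin; near: x; [exact: nbhs_left_gt|exact: nbhs_left_lt].
have [v v0 kv] := orlicz_unbounded phiO k.
exists (Num.max v (D + 1))%R; rewrite ltry lte_fin lt_max; split => //.
  by apply/orP; right; lra.
by apply: (lt_le_trans kv); rewrite orlicz_le// le_max lexx.
Unshelve. all: by end_near. Qed.

(** [P^-1] is the measure that the support of [x] must have, and [m] the measure available. For
    finite [m = r] the level to exceed is [r^-1]; for infinite [m] level 0 suffices. *)
Lemma exists_orlicz_height (m : \bar R) : 0 <= m ->
  orlicz_d phi < orlicz_b phi -> 1 < orlicz_ext phi (orlicz_b phi) * m ->
  exists (a P : R), [/\ orlicz_d phi < a%:E, a%:E < orlicz_b phi,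
    phi a = P%:E, (0 < P)%R & (P^-1)%:E <= m].
Proof.
move=> m0 db; suff H : (1 < orlicz_ext phi (orlicz_b phi) * m) ->
  exists a, [/\ orlicz_d phi < a%:E, a%:E < orlicz_b phi &
    forall P, phi a = P%:E -> (P^-1)%:E <= m].
  move=> /H[a [da ab aP]].
  have a0 : (0 <= a)%R.
    by rewrite -lee_fin ltW// (le_lt_trans (orlicz_d_ge0 phiO)).
  have := lt_orlicz_b_lty a0 ab; have := orlicz_d_lt_gt0 da.
  case PE : (phi a) => [P| |]//; rewrite lte_fin => P0 _.
  by exists a, P; split => //; exact: aP.
case: m m0 => [r| |]//; last first.
  move=> _ _; have [|a [da ab _]] := exists_orlicz_level (k := 0%R) db.
    by move=> b bE; apply: orlicz_d_lt_gt0; rewrite -bE.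
  by exists a; split => // P _; rewrite leey.
rewrite lee_fin le_eqVlt => /predU1P[<-|r0].
  by rewrite mule0 ltNge lee_fin ler01.
move=> mb; have [|a [da ab ka]] := exists_orlicz_level (k := r^-1%R) db.
  by move=> b bE; move: mb; rewrite bE /= -lte_pdivrMr// mul1e.
exists a; split => // P PE; rewrite PE lte_fin in ka.
have P0 : (0 < P)%R by rewrite (lt_trans _ ka)// invr_gt0.
by rewrite lee_fin invf_ple// ltW.
Qed.

(** The height is [c] itself: an infinite [c] would bound [phi] by 1, against its growth. *)
Lemma orlicz_c_attained : orlicz_d phi < orlicz_c phi ->
  orlicz_ext phi (orlicz_c phi) = 1 ->
  exists a : R, [/\ (0 < a)%R, orlicz_d phi < a%:E & phi a = 1].
Proof.
move=> dc; have d0 := orlicz_d_ge0 phiO.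
case cE : (orlicz_c phi) dc => [c| |]/= dc phic.
- exists c; split => //; rewrite -lte_fin.
  exact: le_lt_trans dc.
- have [v v0] := orlicz_unbounded phiO 1; rewrite ltNge => /negP; case.
  have : v%:E < orlicz_c phi by rewrite cE ltry.
  move=> /ereal_sup_gt[_ [w [_ phiw] <-]]; rewrite lte_fin => vw.
  by rewrite (le_trans _ phiw)// (orlicz_le phiO)// ltW.
- by move: dc; rewrite ltNge leNye.
Qed.

End orlicz_levels.

Theorem theorem4p11 (R : realType) :
  (forall (d : measure_display) (T : measurableType d)
      (mu : {sigma_finite_measure set T -> \bar R}) (phi : R -> \bar R),
    measure_is_complete mu ->
    nonatomic mu ->
    orlicz_function phi ->
    1 < orlicz_ext phi (orlicz_b phi) * mu setT ->
    orlicz_d phi < orlicz_b phi ->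
    exists (a : R) (A : set T),
      let x : T -> R := fun t => (a * \1_A t)%R in
      [/\ (0 < a)%R,
          measurable A,
          luxemburg mu phi x = 1,
          uniformly_non_l12_point (orlicz_space mu phi) (luxemburg mu phi) x &
          orlicz_b phi = +oo -> order_continuous mu phi x])
  /\
  (forall phi : R -> \bar R,
    let mu : {measure set nat -> \bar R} := @counting nat R in
    orlicz_function phi ->
    orlicz_d phi < orlicz_c phi ->
    orlicz_ext phi (orlicz_c phi) = 1 ->
    exists (a : R) (A : set nat),
      let x : nat -> R := fun t => (a * \1_A t)%R in
      [/\ (0 < a)%R,
          luxemburg mu phi x = 1,
          uniformly_non_l12_point (orlicz_space mu phi) (luxemburg mu phi) x &
          orlicz_b phi = +oo -> order_continuous mu phi x]).

Proof.
split=> [d T mu phi _ mu_na phiO mb db|phi mu phiO dc phic].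
  have [a [P [da ab PE P0 Pm]]] :=
    exists_orlicz_height phiO (measure_ge0 mu setT) db mb.
  have a0 : (0 < a)%R by rewrite -lte_fin (le_lt_trans (orlicz_d_ge0 phiO)).
  have iP0 : (0 <= P^-1)%R by rewrite invr_ge0 ltW.
  have [A mA muA] := nonatomic_measure_eq mu_na iP0 Pm.
  have phiA : phi a * mu A = 1 by rewrite PE muA -EFinM divff ?gt_eqF.
  (* Taking [a] strictly below [b] leaves a point [a'] beyond it where [phi] is finite, as the
     dilation requires. *)
  have [a' aa' phia'] := lt_orlicz_b ab.
  exists a, A; split => //.
  - exact: luxemburg_cst_indic (ltW a0) mA phiA.
  - exact: uniformly_non_l12_interior phia'.
  move=> bE; apply: order_continuous_cst_indic => //.
  - exact: ltW.
  - by rewrite muA ltry.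
  - by move=> v v0; apply: lt_orlicz_b_lty => //; rewrite bE ltry.
  - exact: orlicz_space_cst_indic (ltW a0) mA phiA.
have [a [a0 da phia]] := orlicz_c_attained phiO dc phic.
(* A singleton has measure 1, matching [phi a = 1], and every function has a constant sign on it. *)
pose A : set nat := [set 0%N].
have mA : measurable A by [].
have muA : mu A = 1.
  rewrite /mu /= /counting ifT; last by apply/asboolP; exact: finite_set1.
  by rewrite /A fset_set1 finmap.cardfs1.
have phiA : phi a * mu A = 1 by rewrite phia muA mule1.
exists a, A; split => //.
- exact: luxemburg_cst_indic (ltW a0) mA phiA.
- apply: uniformly_non_l12_atom => //; last exact: ltW.
  by move=> y; have [y0|/ltW y0] := leP 0%R (y 0%N); [left|right] => _ ->.
move=> bE; apply: order_continuous_cst_indic => //.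
- exact: ltW.
- by rewrite muA ltry.
- by move=> v v0; apply: lt_orlicz_b_lty => //; rewrite bE ltry.
- exact: orlicz_space_cst_indic (ltW a0) mA phiA.
Qed.
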